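(* Let $S\subseteq\omega$ be infinite with $0\in S$, and assume $S$ satisfies hypothesis (H) below. Let $B$ be a Borel subset of $2^\omega$ and $\tau$ a topology on $B$ finer than the induced one such that $([B,\tau],(f^B_n)_{n\in\omega})$ is a converging situation, where $f^B_n$ is the restriction of $f^S_n$ to $B\cap(f^S_n)^{-1}(B)$. Then $A^S\leq^r_c A^S\cap B^2$, where $A^S\cap B^2$ is viewed as a subset of $[B,\tau]\times[B,\tau]$. Hypothesis (H): for every Borel $C\subseteq 2^\omega$ and every topology $\sigma$ on $C$ finer than the induced one such that $([C,\sigma],(f^C_n)_n)$ is a converging situation (with $f^C_n$ the restriction of $f^S_n$ to $C\cap(f^S_n)^{-1}(C)$), and all $l,p\in\omega$, there exist $n\ge l$ and $\gamma$ in the domain of $f^C_n$ with $\mathrm{Card}(\gamma\lceil n)+(S\cap[0,p])=S\cap(\mathrm{Card}(\gamma\lceil n)+[0,p])$.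
   Context: For $s\in 2^{<\omega}$, $\mathrm{Card}(s)$ is the number of $1$'s in $s$; $\gamma\lceil n$ is the sequence of the first $n$ terms of $\gamma$; for $c\in\omega$ and $F\subseteq\omega$, $c+F:=\{c+m:m\in F\}$; $N_s$ is the basic clopen set of $\alpha\in 2^\omega$ extending $s$. For $S\subseteq\omega$, $f^S_n$ is the partial homeomorphism with domain $\bigcup\{N_{s0}: s\in 2^n,\ \mathrm{Card}(s)\in S\}$ defined by $f^S_n(s0\gamma):=s1\gamma$, and $A^S:=\bigcup_n\mathrm{Gr}(f^S_n)=\{(s0\gamma,s1\gamma): s\in 2^{<\omega},\ \mathrm{Card}(s)\in S,\ \gamma\in 2^\omega\}$. $(X,(f_n))$ is a converging situation if $X$ is a nonempty zero-dimensional perfect Polish space, each $f_n$ is a partial homeomorphism of $X$ with clopen domain and range, and $\Delta(X)=\overline{A^f}\setminus A^f$ where $A^f:=\bigcup_n\mathrm{Gr}(f_n)$. $A\leq^r_c A'$ means there are continuous $u,v$ with $A=(u\times v)^{-1}(A')$. *)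

(* Defs.v *)
From HB Require Import structures.
From mathcomp Require Import all_boot all_order all_algebra.
From mathcomp Require Import all_classical all_reals all_analysis.

Set Implicit Arguments.
Unset Strict Implicit.
Unset Printing Implicit Defensive.

Local Open Scope classical_set_scope.

(* Topologies as first-class objects, so that one set may carry several of
   them: [with_topology tau] is [T] with [tau] as its canonical topology,
   whatever topology [T] already has. *)
Record topology (T : choiceType) := Topology {
  is_open : set_system T ;
  is_openT : is_open setT ;
  is_openI : setI_closed is_open ;
  is_open_bigU : forall F : set_system T, F `<=` is_open ->
    is_open (\bigcup_(U in F) U)
}.

Definition with_topology (T : choiceType) (tau : topology T) : Type := T.

Section with_topology_instances.
Context (T : choiceType) (tau : topology T).

Let is_open_bigcup (I : Type) (f : I -> set T) :
  (forall i, is_open tau (f i)) -> is_open tau (\bigcup_i f i).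
Proof.
move=> fo; rewrite -(bigcup_image setT f id).
by apply: is_open_bigU => U [i _ <-].
Qed.

HB.instance Definition _ := Choice.on (with_topology tau).
HB.instance Definition _ := isOpenTopological.Build (with_topology tau)
  (is_openT tau) (@is_openI _ tau) is_open_bigcup.

Lemma open_with_topologyE : @open (with_topology tau) = is_open tau.
Proof. by []. Qed.

End with_topology_instances.

(* A subset carries the induced topology as its canonical one. *)
Definition finer_than_induced (X : topologicalType) (B : set X)
    (tau : topology B) : Prop :=
  forall U : set B, open U -> is_open tau U.

Definition borel (X : topologicalType) : set_system X :=
  <<s [set U : set X | open U] >>.

Definition homeomorphic (X Y : topologicalType) : Prop :=
  exists (h : X -> Y) (k : Y -> X),
    [/\ cancel h k, cancel k h, continuous h & continuous k].

Definition separable (X : topologicalType) : Prop :=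
  exists2 D : set X, countable D & dense D.

Definition completely_metrizable (R : realType) (X : topologicalType) : Prop :=
  exists2 M : metricType R,
    (forall F : set_system M, ProperFilter F -> cauchy F ->
       exists l : M, F --> l) &
    homeomorphic X M.

Definition polish (R : realType) (X : topologicalType) : Prop :=
  separable X /\ completely_metrizable R X.

(* The library's [zero_dimensional] only asks that clopen sets separate
   points, which is weaker than having a base of clopen sets, even for Polish
   spaces. *)
Definition has_clopen_base (X : topologicalType) : Prop :=
  @basis X [set U | clopen U].

(* Partial functions are identified with their graphs. *)
Definition pdom (X Y : Type) (f : set (X * Y)) : set X := fst @` f.
Definition pran (X Y : Type) (f : set (X * Y)) : set Y := snd @` f.

Definition partial_homeomorphism (X : topologicalType)
    (f : set (X * X)) : Prop :=
  exists h k : X -> X,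
    [/\ forall x y, f (x, y) -> y = h x /\ x = k y,
        {within pdom f, continuous h} &
        {within pran f, continuous k}].

Definition union_graph (X : Type) (f : nat -> set (X * X)) : set (X * X) :=
  \bigcup_n f n.

Definition converging_situation (R : realType) (X : topologicalType)
    (f : nat -> set (X * X)) : Prop :=
  [/\ [/\ [set: X] !=set0, has_clopen_base X,
          perfect_set [set: X] & polish R X],
      (forall n, [/\ partial_homeomorphism (f n),
                     clopen (pdom (f n)) & clopen (pran (f n))]) &
      diagonal = closure (union_graph f) `\` union_graph f].

Definition rect_reducible (X Y X' Y' : topologicalType)
    (A : set (X * Y)) (A' : set (X' * Y')) : Prop :=
  exists (u : X -> X') (v : Y -> Y'),
    [/\ continuous u, continuous v & A = [set p | A' (u p.1, v p.2)]].

Definition Card (s : seq bool) : nat := count_mem true s.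

Definition initial_segment (gamma : cantor_space) (n : nat) : seq bool :=
  mkseq gamma n.

Definition concat (s : seq bool) (gamma : cantor_space) : cantor_space :=
  fun k => if (k < size s)%N then nth false s k else gamma (k - size s)%N.

(* Graph of s0gamma |-> s1gamma, for s of length n with Card s in S. *)
Definition fS (S : set nat) (n : nat) : set (cantor_space * cantor_space) :=
  [set p | exists (s : n.-tuple bool) (gamma : cantor_space),
     S (Card s) /\
     p = (concat (rcons s false) gamma, concat (rcons s true) gamma)].

Definition AS (S : set nat) : set (cantor_space * cantor_space) :=
  union_graph (fS S).

Definition trace (X : topologicalType) (B : set X) (tau : topology B)
    (A : set (X * X)) : set (with_topology tau * with_topology tau) :=
  [set p | A (set_val (p.1 : B), set_val (p.2 : B))].
Arguments trace {X B} tau A.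

(* As graphs, the restriction of f to B `&` f^-1(B) is Gr(f) `&` B^2. *)
Definition restricted_fS (S : set nat) (B : set cantor_space)
    (tau : topology B) (n : nat) : set (with_topology tau * with_topology tau) :=
  trace tau (fS S n).
Arguments restricted_fS S {B} tau n.

Definition translate (c : nat) (F : set nat) : set nat :=
  [set (c + m)%N | m in F].

Definition hypothesis_H (R : realType) (S : set nat) : Prop :=
  forall (C : set cantor_space) (sigma : topology C),
    borel C -> finer_than_induced sigma ->
    converging_situation R (restricted_fS S sigma) ->
    forall l p : nat, exists n : nat, (l <= n)%N /\
      exists2 gamma : with_topology sigma, pdom (restricted_fS S sigma n) gamma &
        let c := Card (initial_segment (set_val (gamma : C)) n) in
        translate c (S `&` [set m | (m <= p)%N]) =
        S `&` translate c [set m | (m <= p)%N].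

(* Main.v *)
(* The reduction is u = v, where u(alpha) is a base point w of B whose
   coordinates at places n_0 < n_1 < ... are overwritten by alpha, and w is 0 at
   these places. Then alpha and beta differ exactly at k if and only if u(alpha)
   and u(beta) differ exactly at n_k, and u reduces A^S to itself as soon as
   Card(u(alpha)|n_k) = c_k + Card(alpha|k), with c_k = Card(w|n_k), lies in S
   exactly when Card(alpha|k) does; since Card(alpha|k) <= k, this is the
   conclusion of (H) for p = k.

   The places and the point w come from a decreasing sequence of tau-clopen sets
   V_k: applying (H) to the subspace V_k gives x in V_k and n_k with f_{n_k}(x)
   in V_k, and V_{k+1} is a small neighbourhood of x. All the flips along
   n_0, ..., n_k keep V_{k+1} inside B and have small oscillation on it, so the
   finite modifications of w converge in tau, uniformly in alpha.

   To apply (H) to V_k one needs it to be Borel in the Cantor space: V_k and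
   B \ V_k are disjoint continuous images of Polish spaces, hence are separated
   by a Borel set, and B is Borel. *)
Require Import Defs.
From HB Require Import structures.
From mathcomp Require Import all_boot all_order all_algebra.
From mathcomp Require Import all_classical all_reals all_analysis.
From mathcomp Require Import zify lra.

Set Implicit Arguments.
Unset Strict Implicit.
Unset Printing Implicit Defensive.

Import Order.TTheory GRing.Theory Num.Theory.

Local Open Scope classical_set_scope.
Local Open Scope ring_scope.

(** * Combinatorics of A^S *)

(** Replaces words and concatenations by conditions on coordinates, the form used from here on.
    Conversely, the word is read off as the initial segment of [a] of length [n], and the tail as
    [a] shifted by [n.+1]. *)
Lemma fSP (S : set nat) (n : nat) (a b : cantor_space) :
  fS S n (a, b) <-> [/\ S (Card (initial_segment a n)),
    a n = false, b n = true & forall m, m <> n -> a m = b m].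
Proof.
split=> [[s [gamma [Ss [-> ->]]]]|[Sa an bn ab]].
- have concatE c : concat (rcons s c) gamma = fun k : nat =>
      if (k < n)%N then nth false s k
      else if k == n then c else gamma (k - n.+1)%N.
    apply/funext => k; rewrite /concat size_rcons size_tuple nth_rcons.
    rewrite size_tuple ltnS leq_eqVlt.
    by case: ltngtP => // kn; rewrite ltnn.
  split; rewrite ?concatE ?ltnn ?eqxx//.
  + suff -> : initial_segment (fun k : nat =>
        if (k < n)%N then nth false s k
        else if k == n then false else gamma (k - n.+1)%N) n = s by [].
    apply: (@eq_from_nth _ false); rewrite size_mkseq ?size_tuple// => i i_n.
    by rewrite nth_mkseq// i_n.
  + by move=> m /eqP/negbTE mn; rewrite mn.
- have ss : size (initial_segment a n) == n by rewrite size_mkseq.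
  exists (Tuple ss), (fun k => a (n.+1 + k)%N); split=> //=.
  have concatE c : concat (rcons (initial_segment a n) c)
      (fun k => a (n.+1 + k)%N) = fun k : nat => if k == n then c else a k.
    apply/funext => k; rewrite /concat size_rcons size_mkseq nth_rcons.
    rewrite size_mkseq ltnS leq_eqVlt.
    case: ltngtP => // kn; first by rewrite nth_mkseq.
    by rewrite subnKC.
  rewrite !concatE; congr (_, _); apply/funext => k; case: eqP => [->//|] //.
  by move=> /ab ->.
Qed.

Lemma Card_initial_segment (a : cantor_space) (n : nat) :
  Card (initial_segment a n) = (\sum_(i < n) a i)%N.
Proof.
rewrite /Card /initial_segment -sum1_count /mkseq big_map big_mkcond/=.
rewrite -{1}[n]subn0 -/(index_iota 0 n) big_mkord.
by apply: eq_bigr => i _; case: (a i).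
Qed.

Lemma Card_initial_segment_le (a : cantor_space) (n : nat) :
  (Card (initial_segment a n) <= n)%N.
Proof. by rewrite (leq_trans (count_size _ _))// size_mkseq. Qed.

Lemma eq_initial_segment (a b : cantor_space) (n : nat) :
  (forall m, (m < n)%N -> a m = b m) -> initial_segment a n = initial_segment b n.
Proof.
by move=> ab; apply/eq_in_map => m; rewrite mem_iota => /andP[_ /ab].
Qed.

Lemma Card_initial_segment_fS (S : set nat) (n L : nat) (a b : cantor_space) :
  fS S n (a, b) -> (n < L)%N ->
  Card (initial_segment b L) = (Card (initial_segment a L)).+1.
Proof.
move=> /fSP[_ an bn ab] nL; rewrite !Card_initial_segment.
rewrite (bigD1 (Ordinal nL))//= [in RHS](bigD1 (Ordinal nL))//= an bn add1n.
by congr _.+1; apply: eq_bigr => i /eqP ni; rewrite ab// => i_n; apply/ni/val_inj.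
Qed.

(** The pointwise form in which the conclusion of (H) is used; the backward direction cancels
    [c]. *)
Lemma translate_mem (S : set nat) (c p j : nat) :
  translate c (S `&` [set m | (m <= p)%N]) =
    S `&` translate c [set m | (m <= p)%N] ->
  (j <= p)%N -> S j <-> S (c + j)%N.
Proof.
move=> E jp; split=> [Sj|Scj].
- by have [] : (S `&` translate c [set m | (m <= p)%N]) (c + j)%N;
    first by rewrite -E; exists j.
- have [i [Si _] /addnI <-//] : translate c (S `&` [set m | (m <= p)%N]) (c + j)%N.
  by rewrite E; split=> //; exists j.
Qed.

Lemma nat_dependent_choice (T : Type) (P : nat -> T -> Prop)
    (Q : nat -> T -> T -> Prop) (t0 : T) :
  P 0%N t0 ->
  (forall n t, P n t -> exists t', P n.+1 t' /\ Q n t t') ->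
  exists u : nat -> T,
    [/\ u 0%N = t0, forall n, P n (u n) & forall n, Q n (u n) (u n.+1)].
Proof.
move=> P0 PQ.
(* Choice wants a total relation: where the invariant [P] fails, [t] itself is a dummy value. *)
have /choice[f fP] : forall x : nat * T, exists t', P x.1 x.2 ->
    P x.1.+1 t' /\ Q x.1 x.2 t'.
  move=> [n t]; have [/PQ[t' ?]|nP] := pselect (P n t); first by exists t'.
  by exists t.
pose u := fix u n := if n is m.+1 then f (m, u m) else t0.
have uP n : P n (u n) by elim: n => //= n /(fP (_, _))[].
by exists u; split=> // n; have [] := fP (n, u n) (uP n).
Qed.

(** * Borel separation *)

Definition complete_space (T : uniformType) : Prop :=
  forall F : set_system T, ProperFilter F -> cauchy F -> exists l : T, F --> l.

Lemma harmonic_lt (R : realType) (r : R) : 0 < r -> exists k, harmonic k < r.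
Proof.
move=> r0; have [k _ kr] := cvgr_lt 0 (@cvg_harmonic R) r r0.
by exists k; apply: kr => /=.
Qed.

(** The second [harmonic k] in the estimate pays for the passage from a late term of the sequence to
    the limit. *)
Lemma complete_cvg (R : realType) (M : pseudoMetricType R) (x : nat -> M) :
  complete_space M ->
  (forall k m m', (k <= m)%N -> (k <= m')%N -> ball (x m) (harmonic k) (x m')) ->
  exists2 l : M, x @ \oo --> l &
    forall k m, (k <= m)%N -> ball (x m) (harmonic k + harmonic k) l.
Proof.
move=> cM xC; have [|l xl] := cM (x @ \oo) _.
  apply: cauchy_exP => e e0; have [k ke] := harmonic_lt e0.
  exists (x k); exists k => // m /= km.
  by apply: le_ball (ltW ke) _ _; exact: xC.
exists l => // k m km.
have /cvg_ballP/(_ (harmonic k) (harmonic_gt0 _))[N _ Nl] := xl.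
apply: (@ball_triangle _ _ (x (maxn N k))).
  by apply: xC => //; rewrite leq_maxr.
by apply: ball_sym; apply: Nl; rewrite /= leq_maxl.
Qed.

Lemma borelC (T : topologicalType) (A : set T) : borel A -> borel (~` A).
Proof. by move=> bA; rewrite -setTD /borel; apply: sigma_algebraCD. Qed.

Lemma borelI (T : topologicalType) (A B : set T) :
  borel A -> borel B -> borel (A `&` B).
Proof.
move=> bA bB; rewrite -[A `&` B]setCK setCI; apply: borelC.
rewrite -bigcup2E; apply: sigma_algebra_bigcup => -[|[|n]] /=.
- exact: borelC.
- exact: borelC.
- exact: sigma_algebra0.
Qed.

Lemma borel_bigcap (T : topologicalType) (A : nat -> set T) :
  (forall i, borel (A i)) -> borel (\bigcap_i A i).
Proof.
move=> bA; rewrite -[\bigcap_i A i]setCK setC_bigcap; apply: borelC.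
by apply: sigma_algebra_bigcup => i; exact: borelC.
Qed.

Definition borel_separated (T : topologicalType) (A B : set T) : Prop :=
  exists E : set T, [/\ borel E, A `<=` E & E `&` B = set0].

(** Intersect the separating sets over [j], then take the union over [i]. By contraposition, a
    nonseparated pair of countable unions contains a nonseparated pair of pieces. *)
Lemma borel_separated_bigcup (T : topologicalType) (A B : nat -> set T) :
  (forall i j, borel_separated (A i) (B j)) ->
  borel_separated (\bigcup_i A i) (\bigcup_j B j).
Proof.
move=> sAB.
have /choice[E EP] : forall ij : nat * nat, exists E : set T,
  [/\ borel E, A ij.1 `<=` E & E `&` B ij.2 = set0] by move=> ij; exact: sAB.
exists (\bigcup_i \bigcap_j E (i, j)); split.
- by apply: sigma_algebra_bigcup => i; apply: borel_bigcap => j; case: (EP (i, j)).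
- by move=> x [i _ Aix]; exists i => // j _; have [_ + _] := EP (i, j); exact.
- rewrite -subset0 => x [[i _ Eix] [j _ Bjx]].
  by have [_ _ <-] := EP (i, j); split=> //; exact: Eix.
Qed.

Lemma separable_cover (R : realType) (M : pseudoMetricType R) (e : R) :
  separable M -> [set: M] !=set0 -> 0 < e ->
  exists c : nat -> M, forall x, exists i, ball (c i) e x.
Proof.
move=> [D cD dD] [x0 _] e0.
have [y0 [_ Dy0]] := dD setT (ex_intro _ x0 I) openT.
have /pfcard_geP[DE|/unsquash c] := cD; first by rewrite DE in Dy0.
exists c => x.
have [|y [xy Dy]] := dD (ball x e)° _ (@open_interior _ _).
  by exists x; exact: nbhsx_ballx.
have [i _ ciy] := @surj _ _ _ _ c _ Dy.
by exists i; apply: ball_sym; rewrite ciy; exact: interior_subset.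
Qed.

(* Nonseparated pairs refine to nonseparated pairs of arbitrarily small sets;
   these shrink to two points with distinct images, which open sets separate. *)
Lemma lusin_separation (R : realType) (M : pseudoMetricType R)
    (T : topologicalType) (g : M -> T) (A B : set M) :
  complete_space M -> separable M -> hausdorff_space T -> continuous g ->
  closed A -> closed B -> g @` A `&` g @` B = set0 ->
  borel_separated (g @` A) (g @` B).
Proof.
move=> cM sM hT cg Acl Bcl AB0; apply: contrapT => nsAB.
have sub U V (U' V' : set T) : U `<=` U' -> V `<=` V' ->
    borel_separated U' V' -> borel_separated U V.
  move=> UU' VV' [E [bE U'E EV']]; exists E; split=> //.
    exact: subset_trans U'E.
  by rewrite -subset0 -EV'; exact: setIS.
(* An empty side would be separated trivially, by the empty set or by the whole space. *)
have neq0 (U V : set M) : ~ borel_separated (g @` U) (g @` V) ->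
    U !=set0 /\ V !=set0.
  move=> ns; split; apply: contrapT => /nonemptyPn E0; apply: ns; rewrite E0.
    exists set0; split; [exact: sigma_algebra0|by move=> x []|by rewrite set0I].
  rewrite image_set0; exists setT; split=> //; last by rewrite setI0.
  by rewrite -setC0; apply: borelC; exact: sigma_algebra0.
have MT : [set: M] !=set0 by have [[x _] _] := neq0 _ _ nsAB; exists x.
pose P (n : nat) (UV : set M * set M) :=
  ~ borel_separated (g @` UV.1) (g @` UV.2).
pose small n (U : set M) := forall x y, U x -> U y -> ball x (harmonic n : R) y.
pose Q (n : nat) (UV UV' : set M * set M) :=
  [/\ UV'.1 `<=` UV.1, UV'.2 `<=` UV.2, small n UV'.1 & small n UV'.2].
have [n [U V] nsUV|W [W0 WP WQ]] := @nat_dependent_choice _ P Q (A, B) nsAB.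
  have e0 : (0 : R) < harmonic n / 2 by rewrite divr_gt0// harmonic_gt0.
  have [c cP] := separable_cover sM MT e0.
  have cover (Z : set M) :
      g @` Z `<=` \bigcup_i (g @` (Z `&` ball (c i) (harmonic n / 2))).
    by move=> _ [z Zz <-]; have [i zi] := cP z; exists i => //; exists z.
  have smallI (Z : set M) i : small n (Z `&` ball (c i) (harmonic n / 2)).
    by move=> x y [_ cx] [_ cy]; apply: ball_splitr cx cy.
  apply: contrapT => nex; apply: nsUV => /=.
  apply: sub (cover U) (cover V) _; apply: borel_separated_bigcup => i j.
  apply: contrapT => ns; apply: nex.
  exists (U `&` ball (c i) (harmonic n / 2), V `&` ball (c j) (harmonic n / 2)).
  by split=> //; split; [exact: subIsetl|exact: subIsetl|exact: smallI|exact: smallI].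
have Wle : forall k m, (k <= m)%N -> (W m).1 `<=` (W k).1 /\ (W m).2 `<=` (W k).2.
  move=> k; elim=> [|m IH]; first by rewrite leqn0 => /eqP->; split.
  rewrite leq_eqVlt => /predU1P[->|]; [by split|rewrite ltnS => /IH[W1 W2]].
  by have [W1' W2' _ _] := WQ m; split; [exact: subset_trans W1|exact: subset_trans W2].
(* Stated for an arbitrary [pr] so as to serve both sides, with [pr] being [fst] or [snd]. *)
have limit (pr : set M * set M -> set M) (Z : set M) :
    (forall n, small n (pr (W n.+1))) -> (forall n, pr (W n) !=set0) ->
    (forall k m, (k <= m)%N -> pr (W m) `<=` pr (W k)) ->
    closed Z -> pr (W 0%N) `<=` Z ->
    exists2 l, Z l & forall O, nbhs (g l) O -> exists k, forall m, (k <= m)%N ->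
      g @` pr (W m) `<=` O.
  move=> smallW W_neq0 Wm Zcl WZ.
  have /choice[x xW] n : exists x, pr (W n.+1) x by have [x ?] := W_neq0 n.+1; exists x.
  have [k m m' km km'|l xl lP] := @complete_cvg R M x cM.
    by apply: smallW; [exact: (Wm _ m.+1)|exact: (Wm _ m'.+1)].
  exists l.
    apply: (closed_cvg Z Zcl _ l xl); apply: nearW => n.
    by apply: WZ; apply: (Wm 0%N n.+1) => //.
  move=> O /cg /nbhs_ballP[r /= r0 rO].
  (* Two of the thirds go from the limit to [x k], the last one from [x k] to [y]. *)
  have [k kr] : exists k, harmonic k < r / 3 by apply: harmonic_lt; rewrite divr_gt0.
  exists k.+1 => m km _ [y Wy <-]; apply: rO.
  apply: (@le_ball _ _ _ ((harmonic k + harmonic k) + harmonic k)).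
    by move: kr; rewrite ltr_pdivlMr// => /ltW; lra.
  apply: (@ball_triangle _ _ (x k)); first by apply/ball_sym; exact: lP.
  by apply: smallW; [exact: xW|exact: Wm km _ _].
have [|||||a Aa aP] := limit fst A.
- by move=> n; have [] := WQ n.
- by move=> n; have [] := neq0 _ _ (WP n).
- by move=> k m /Wle[].
- by [].
- by rewrite W0.
have [|||||b Bb bP] := limit snd B.
- by move=> n; have [] := WQ n.
- by move=> n; have [] := neq0 _ _ (WP n).
- by move=> k m /Wle[].
- by [].
- by rewrite W0.
have /eqP gab : g a <> g b.
  move=> gab; suff : (g @` A `&` g @` B) (g a) by rewrite AB0.
  by split; [exists a|exists b].
move: hT; rewrite open_hausdorff => /(_ _ _ gab)[[G1 G2]/= [aO1 bO2] [oO1 oO2 O120]].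
have [|k1 k1P] := aP G1; first by apply: open_nbhs_nbhs; split=> //; exact: set_mem.
have [|k2 k2P] := bP G2; first by apply: open_nbhs_nbhs; split=> //; exact: set_mem.
(* At this stage the open set [G1] itself separates the two images, contradicting the invariant. *)
apply: (WP (maxn k1 k2)); exists G1; split.
- exact: sub_sigma_algebra.
- by apply: k1P; rewrite leq_maxl.
- rewrite -subset0 -(eqP O120); apply: setIS.
  by apply: k2P; rewrite leq_maxr.
Qed.

(** * Clopen subspaces of a converging situation *)

Lemma clopen_baseP (X : topologicalType) (x : X) (N : set X) :
  has_clopen_base X -> nbhs x N -> exists U, [/\ clopen U, U x & U `<=` N].
Proof. by move=> [_ /(_ x) Xx] /Xx[U [cU Ux] UN]; exists U. Qed.

(** A homeomorphism onto a clopen subset. Using a map instead of a subset lets the subspace be a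
    type with its own topology. *)
Definition clopen_embedding (X Y : topologicalType) (j : Y -> X) : Prop :=
  [/\ injective j, continuous j, forall O, open O -> open (j @` O) &
      closed (range j)].

Lemma clopen_embedding_nbhs (X Y : topologicalType) (j : Y -> X) (y : Y) (N : set Y) :
  clopen_embedding j -> nbhs y N -> nbhs (j y) (j @` N).
Proof.
move=> [_ _ jo _]; rewrite !nbhsE => -[U [oU Uy] UN].
by exists (j @` U); [split; [exact: jo|exists y]|exact: image_subset].
Qed.

(** The inverse is made total by arbitrary values off the range, whence the nonemptiness of [Y]. It
    is continuous at points of the range because [j] is open. *)
Lemma clopen_embedding_inv (X Y : topologicalType) (j : Y -> X) :
  clopen_embedding j -> [set: Y] !=set0 ->
  exists2 i : X -> Y, cancel j i & forall y, {for j y, continuous i}.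
Proof.
move=> jP [y0 _]; have [j_inj _ _ _] := jP.
have /choice[i iP] : forall x, exists y, range j x -> j y = x.
  by move=> x; have [[y _ <-]|?] := pselect (range j x); [exists y|exists y0].
have ji : cancel j i by move=> y; apply/j_inj/iP; exists y.
exists i => // y N; rewrite ji => /(clopen_embedding_nbhs jP).
by apply: filterS => _ [z Nz <-]; rewrite /= ji.
Qed.

Lemma clopen_embedding_base (X Y : topologicalType) (j : Y -> X) :
  clopen_embedding j -> has_clopen_base X -> has_clopen_base Y.
Proof.
move=> jP Xb; have [j_inj jc _ _] := jP; split=> [U []//|y N].
move=> /(clopen_embedding_nbhs jP)/(clopen_baseP Xb)[U [cU Uy UN]].
exists (j @^-1` U); first by split=> //; exact: clopen_comp.
by move=> z /UN[z' Nz' /j_inj <-].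
Qed.

Lemma clopen_embedding_perfect (X Y : topologicalType) (j : Y -> X) :
  clopen_embedding j -> perfect_set [set: X] -> perfect_set [set: Y].
Proof.
move=> jP [_ Xl]; split; first exact: closedT.
rewrite -subTset => y _ N /(clopen_embedding_nbhs jP) Ny.
have : limit_point setT (j y) by rewrite Xl.
move=> /(_ _ Ny)[x [zy _ [z Nz jz]]]; exists z; split=> //.
by move: zy; rewrite -jz; apply: contra_neq => ->.
Qed.

Lemma clopen_embedding_separable (X Y : topologicalType) (j : Y -> X) :
  clopen_embedding j -> separable X -> separable Y.
Proof.
move=> [j_inj jc jo _] [D /countable_injP[e e_inj] dD]; exists (j @^-1` D).
  apply/countable_injP; exists (e \o j) => x y; rewrite !inE => Dx Dy /e_inj.
  by rewrite !inE => /(_ Dx Dy)/j_inj.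
move=> O [y Oy] oO; have [|_ [[z Oz <-] Dz]] := dD (j @` O) _ (jo _ oO).
  by exists (j y); exists y.
by exists z.
Qed.

(** A copy of [Y] that receives the metric induced by [f]; the type carries [f_inj] because the
    metric axioms of the instance depend on it. *)
Definition pullback_metric (R : realType) (Y : choiceType) (M : metricType R)
  (f : Y -> M) (f_inj : injective f) : Type := Y.

Section pullback_metric_instances.
Context (R : realType) (Y : choiceType) (M : metricType R) (f : Y -> M).
Context (f_inj : injective f).

Let pdist (x y : pullback_metric f_inj) : R := mdist (f x) (f y).

Let pdistxx x : pdist x x = 0. Proof. exact: mdistxx. Qed.

Let pdist_positivity x y : pdist x y = 0 -> x = y.
Proof. by move/mdist_positivity/f_inj. Qed.

Let pdist_sym x y : pdist x y = pdist y x. Proof. exact: metric_sym. Qed.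

Let pdist_triangle y x z : pdist x z <= pdist x y + pdist y z.
Proof. exact: metric_triangle. Qed.

HB.instance Definition _ := Choice.on (pullback_metric f_inj).
HB.instance Definition _ := isMetric.Build R (pullback_metric f_inj)
  pdistxx pdist_positivity pdist_sym pdist_triangle.

Lemma pullback_ballE (x : pullback_metric f_inj) (e : R) :
  ball x e = f @^-1` ball (f x) e.
Proof. by rewrite !ballEmdist. Qed.

End pullback_metric_instances.

(** The metric of [M] is restricted to the image of [Y]. It induces the topology of [Y] because [j]
    is open, and it is complete because the image is closed in [M]. *)
Lemma clopen_embedding_completely_metrizable (R : realType)
    (X Y : topologicalType) (j : Y -> X) :
  clopen_embedding j -> completely_metrizable R X -> completely_metrizable R Y.
Proof.
move=> jP [M cM [h [k [hK kK hc kc]]]].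
have [j_inj jc jo jcl] := jP.
pose f := h \o j.
have f_inj : injective f by move=> x y /(can_inj hK)/j_inj.
have fc : continuous f.
  by move=> y; apply: continuous_comp; [exact: jc|exact: hc].
exists (pullback_metric f_inj); last first.
  exists id, id; split=> //= y N.
    move=> /nbhs_ballP[e /= e0]; rewrite pullback_ballE => eN.
    by apply: filterS eN _; apply: fc; exact: nbhsx_ballx.
  move=> /(clopen_embedding_nbhs jP) jN.
  have : nbhs (f y) (k @^-1` (j @` N)) by apply: kc; rewrite /f /= hK.
  move=> /nbhs_ballP[e e0 eN]; apply/nbhs_ballP; exists e => //= z.
  by rewrite pullback_ballE => /eN[z' Nz']; rewrite /= /f /= hK => /j_inj <-.
move=> F FF /cauchyP Fc.
have [|l fl] := cM (f @ F) _.
  apply/cauchy_exP => e e0; have [x] := Fc e e0.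
  by rewrite pullback_ballE; exists (f x).
have lf : range f l.
  suff [y _ jy] : (k @^-1` range j) l by exists y => //; rewrite /f/= jy kK.
  apply: (closed_cvg (k @^-1` range j) _ _ l fl).
    by apply: preimage_closed => // x _; exact: kc.
  by apply: filterE => y; exists y => //; rewrite /f/= hK.
have [y _ fyl] := lf; exists y => N /nbhs_ballP[e e0].
rewrite pullback_ballE fyl => eN; apply: filterS eN _.
by apply: fl; exact: nbhsx_ballx.
Qed.

Lemma within_clopen_preimage (X Y : topologicalType) (A : set X) (h : X -> Y)
    (U : set Y) :
  clopen A -> {within A, continuous h} -> clopen U -> clopen (A `&` h @^-1` U).
Proof.
move=> [oA cA] hc; rewrite continuous_open_subspace// in hc.
have openAh (W : set Y) : open W -> open (A `&` h @^-1` W).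
  move=> oW; rewrite openE => x [Ax Wx]; apply: filterI.
    exact: open_nbhs_nbhs.
  by apply: (hc x (mem_set Ax)); exact: open_nbhs_nbhs.
move=> [oU cU]; split; first exact: openAh.
(* As [h] is controlled only within [A], closedness comes from this complement, a union of two open
   sets. *)
suff -> : A `&` h @^-1` U = ~` (~` A `|` (A `&` h @^-1` (~` U))).
  by apply: open_closedC; apply: openU; [rewrite openC|apply: openAh; rewrite openC].
by rewrite setCU setCK setCI preimage_setC setCK setIUr setICr set0U.
Qed.

Definition pullback (X Y : Type) (j : Y -> X) (A : set (X * X)) : set (Y * Y) :=
  [set p | A (j p.1, j p.2)].

(** In this form the domain of a restricted partial map is seen to be clopen by
    [within_clopen_preimage]. *)
Lemma pdom_pullback (X Y : Type) (j : Y -> X) (A : set (X * X)) (h : X -> X) :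
  (forall x y, A (x, y) -> y = h x) ->
  pdom (pullback j A) = j @^-1` (pdom A `&` h @^-1` range j).
Proof.
move=> Ah; apply/seteqP; split=> [_ [[y z] /= Ayz <-]|y [[[x x'] /= Axx' xjy]]].
  by split; [exists (j y, j z)|exists z => //; exact: Ah].
by move=> [z _ jz]; exists (y, z) => //=; rewrite /pullback/= jz -xjy -(Ah _ _ Axx').
Qed.

Lemma pran_pdom (X Y : Type) (A : set (X * Y)) :
  pran A = pdom [set p | A (p.2, p.1)].
Proof.
by apply/seteqP; split=> [_ [[x y] Axy <-]|_ [[y x] Axy <-]]; exists (y, x) || exists (x, y).
Qed.

(** One half of a partial homeomorphism; it is applied to the graph and to its transpose, whose
    domain is the range. *)
Lemma clopen_embedding_partial_map (X Y : topologicalType) (j : Y -> X)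
    (i : X -> Y) (A : set (X * X)) (h : X -> X) :
  clopen_embedding j -> (forall y, {for j y, continuous i}) ->
  (forall x y, A (x, y) -> y = h x) ->
  {within pdom A, continuous h} -> clopen (pdom A) ->
  clopen (pdom (pullback j A)) /\
  {within pdom (pullback j A), continuous (i \o h \o j)}.
Proof.
move=> [j_inj jc jo jcl] ic Ah hc cA.
have cpA : clopen (pdom (pullback j A)).
  rewrite (pdom_pullback _ Ah); apply: clopen_comp => //.
  apply: within_clopen_preimage => //; split=> //; exact/jo/openT.
split=> //; have [oA _] := cA; have [opA _] := cpA.
rewrite continuous_open_subspace// in hc; rewrite continuous_open_subspace// => y.
rewrite inE (pdom_pullback _ Ah) => -[Ajy [z _ jz]].
apply: continuous_comp; first exact: jc.
by apply: continuous_comp; [apply: hc; exact: mem_set|rewrite -jz; exact: ic].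
Qed.

Lemma clopen_embedding_partial_homeomorphism (X Y : topologicalType) (j : Y -> X)
    (A : set (X * X)) :
  clopen_embedding j -> [set: Y] !=set0 ->
  [/\ partial_homeomorphism A, clopen (pdom A) & clopen (pran A)] ->
  [/\ partial_homeomorphism (pullback j A), clopen (pdom (pullback j A)) &
      clopen (pran (pullback j A))].
Proof.
move=> jP Y0 [[h [k [hk hc kc]]]]; rewrite pran_pdom in kc * => cd cr.
have [i ji ic] := clopen_embedding_inv jP Y0.
have [cd' hc'] := clopen_embedding_partial_map jP ic
  (fun x y Axy => proj1 (hk x y Axy)) hc cd.
have [cr' kc'] := @clopen_embedding_partial_map _ _ _ _ [set p | A (p.2, p.1)] _
  jP ic (fun y x Axy => proj2 (hk x y Axy)) kc cr.
rewrite pran_pdom; split=> //; exists (i \o h \o j), (i \o k \o j).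
rewrite pran_pdom; split=> // y z /hk[jz jy] /=.
by rewrite -jz -jy !ji.
Qed.

Lemma clopen_embedding_converging (R : realType) (X Y : topologicalType)
    (j : Y -> X) (f : nat -> set (X * X)) :
  clopen_embedding j -> [set: Y] !=set0 ->
  converging_situation R f ->
  converging_situation R (fun n => pullback j (f n)).
Proof.
move=> jP Y0 [[X0 Xb Xp [Xs Xm]] fP fcl]; have [j_inj jc jo jcl] := jP.
split.
- split=> //; first exact: clopen_embedding_base jP Xb.
  + exact: clopen_embedding_perfect jP Xp.
  + split; first exact: clopen_embedding_separable jP Xs.
    exact: clopen_embedding_completely_metrizable jP Xm.
- by move=> n; exact: clopen_embedding_partial_homeomorphism.
apply/seteqP; split=> [[y z]|[y z]]; rewrite /diagonal /=.
- move=> <-; have : (closure (union_graph f) `\` union_graph f) (j y, j y).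
    by rewrite -fcl.
  move=> [jycl jyf]; split; last by move=> [n _ fn]; apply: jyf; exists n.
  move=> N [[P Q] /= [Py Qy] PQN].
  (* Since [j] is open, these images are neighbourhoods; they force the approximating pair into the
     range of [j]. *)
  have [|[a b] [[n _ fn] [[p Pp /= jp] [q Qq /= jq]]]] := jycl (j @` P `*` j @` Q).
    by exists (j @` P, j @` Q) => //; split=> /=; exact: clopen_embedding_nbhs.
  exists (p, q); split; last exact: PQN.
  by exists n => //; rewrite /pullback/= jp jq.
- move=> [yzcl yzf]; apply: j_inj; suff : diagonal (j y, j z) by [].
  rewrite fcl; split; last by move=> [n _ fn]; apply: yzf; exists n.
  move=> N [[P Q] /= [Py Qz] PQN].
  have [|[p q] [[n _ fn] [/= Pp Qq]]] := yzcl (j @^-1` P `*` j @^-1` Q).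
    by exists (j @^-1` P, j @^-1` Q) => //; split; exact: jc.
  by exists (j p, j q); split; [exists n|exact: PQN].
Qed.

(** * Hypothesis (H) on a clopen subspace *)

(* [v @` V] is cut out of [range v] by a Borel set separating it from
   [v @` (~` V)]. *)
Lemma borel_image_clopen (R : realType) (X T : topologicalType) (v : X -> T)
    (V : set X) :
  injective v -> continuous v -> hausdorff_space T -> polish R X ->
  borel (range v) -> clopen V -> borel (v @` V).
Proof.
move=> v_inj vc hT [[D cD dD] [M cM [h [k [hK kK hc kc]]]]] bv [oV cV].
have hk_img (A : set X) : (v \o k) @` (k @^-1` A) = v @` A.
  apply/seteqP; split=> [_ [m kmA <-]|_ [x Ax <-]]; first by exists (k m).
  by exists (h x); rewrite /= hK.
have closedk (A : set X) : closed A -> closed (k @^-1` A).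
  by move=> cA; apply: preimage_closed => // x _; exact: kc.
have [|||||||E [bE VE EV]] := @lusin_separation R M T (v \o k)
    (k @^-1` V) (k @^-1` ~` V).
- exact: cM.
- exists (h @` D).
    by apply: sub_countable (card_image_le _ _) cD.
  move=> O [m Om] oO; have [||x [hxO Dx]] := dD (h @^-1` O).
  + by exists (k m); rewrite /= kK.
  + by move/continuousP : hc; apply.
  + by exists (h x); split=> //; exists x.
- exact: hT.
- by move=> m; apply: continuous_comp; [exact: kc|exact: vc].
- exact: closedk.
- by apply: closedk; rewrite closedC.
- rewrite !hk_img -subset0 => _ [[x Vx <-] [y nVy /v_inj yx]].
  by apply: nVy; rewrite yx.
rewrite !hk_img in VE EV.
suff -> : v @` V = E `&` range v by exact: borelI.
apply/seteqP; split=> [t Vt|t [Et [x _ xt]]].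
  by split; [exact: VE|move: Vt => [x _ <-]; exists x].
apply: contrapT => Vt; suff : (E `&` v @` (~` V)) t by rewrite EV.
by split=> //; exists x => // Vx; apply: Vt; exists x.
Qed.

(** (H) quantifies over topologies as records, so the initial topology along [j] has to be packed as
    one. The proof is transparent so that its open sets can be computed. *)
Definition canonical_topology (X : topologicalType) : topology X.
Proof.
refine (@Topology X open openT (@openI X) _).
by move=> F Fo; apply: bigcup_open.
Defined.

Lemma initial_clopen_embedding (Y : choiceType) (X : topologicalType) (j : Y -> X) :
  injective j -> clopen (range j) ->
  clopen_embedding (j : with_topology (canonical_topology (initial_topology j)) -> X).
Proof.
move=> j_inj [oj cj]; split=> //.
  by apply/continuousP => A oA; exists A.
move=> _ [U oU <-]; suff -> : j @` (j @^-1` U) = U `&` range j by exact: openI.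
apply/seteqP; split=> [_ [y Uy <-]|x [Ux [y _ jy]]]; first by split=> //; exists y.
by exists y; rewrite /= jy.
Qed.

Lemma near_coordinate (X : topologicalType) (pt : X -> cantor_space) (x : X)
    (m : nat) :
  continuous pt -> \forall y \near x, pt y m = pt x m.
Proof.
move=> ptc; have ptmc : {for x, continuous (fun y => pt y m)}.
  apply: (@continuous_comp _ _ _ pt (fun a : cantor_space => a m)).
    exact: ptc.
  exact: (@proj_continuous nat (fun=> bool) m).
apply: (ptmc [set pt x m]); rewrite nbhs_principalE; exact/principal_filterP.
Qed.

Lemma near_initial_segment (X : topologicalType) (pt : X -> cantor_space) (x : X)
    (n : nat) :
  continuous pt ->
  \forall y \near x, initial_segment (pt y) n = initial_segment (pt x) n.
Proof.
move=> ptc; elim: n => [|n IH]; first by near=> y.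
apply: filterS2 (near_coordinate x n ptc) IH => y yn.
by rewrite /initial_segment !mkseqS yn => ->.
Unshelve. all: by end_near.
Qed.

Section finer_topology.
Context (B : set cantor_space) (tau : topology B).

Definition point_of (x : with_topology tau) : cantor_space := set_val (x : B).

Lemma point_of_inj : injective point_of.
Proof. by move=> x y; exact: val_inj. Qed.

Lemma range_point_of : range point_of = B.
Proof.
apply/seteqP; split=> [_ [x _ <-]|a Ba]; first exact: set_valP.
by exists (SigSub (mem_set Ba)).
Qed.

Lemma point_of_continuous : finer_than_induced tau -> continuous point_of.
Proof. by move=> tau_finer; apply/continuousP => A oA; apply: tau_finer; exists A. Qed.

End finer_topology.

Lemma hypothesis_H_clopen (R : realType) (S : set nat) (B : set cantor_space)
    (tau : topology B) (V : set (with_topology tau)) :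
  hypothesis_H R S -> borel B -> finer_than_induced tau ->
  converging_situation R (restricted_fS S tau) ->
  clopen V -> V !=set0 -> forall l p : nat,
  exists n x y, [/\ (l <= n)%N, V x, V y, fS S n (point_of x, point_of y) &
    forall i, (i <= p)%N ->
      S i <-> S (Card (initial_segment (point_of x) n) + i)%N].
Proof.
move=> HS bB tau_finer convB cV [x0 Vx0] l p.
set C := (@point_of B tau) @` V.
(* [C] is a set of bare points of the Cantor space; [j] sends each back to [V], and pulling tau back
   along [j] gives the topology on [C]. *)
have /choice[j jP] : forall c : C, exists x, V x /\ point_of x = set_val c.
  by move=> c; have [x Vx xc] := set_valP c; exists x.
have j_inj : injective j.
  by move=> c d jcd; apply: val_inj; rewrite -[LHS](jP c).2 -[RHS](jP d).2 jcd.
have range_j : range j = V.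
  apply/seteqP; split=> [_ [c _ <-]|x Vx]; first exact: (jP c).1.
  have Cx : C (point_of x) by exists x.
  exists (SigSub (mem_set Cx)) => //; apply: point_of_inj.
  by rewrite (jP _).2.
pose sigma := canonical_topology (initial_topology j).
have jE : clopen_embedding (j : with_topology sigma -> with_topology tau).
  by apply: initial_clopen_embedding; rewrite ?range_j.
have bC : borel C.
  have [[_ _ _ Xpol] _ _] := convB.
  apply: borel_image_clopen Xpol _ cV.
  - exact: point_of_inj.
  - exact: point_of_continuous.
  - exact: cantor_space_hausdorff.
  - by rewrite range_point_of.
have sigma_finer : finer_than_induced sigma.
  have /continuousP pc := point_of_continuous tau_finer.
  move=> _ [U oU <-]; exists (@point_of B tau @^-1` U); first exact: pc.
  by apply/seteqP; split=> c /=; rewrite (jP c).2.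
have [|n [ln [x [[x' y] xy /= <-] nP]]] := HS C sigma bC sigma_finer _ l p.
  have -> : restricted_fS S sigma = fun n => pullback j (restricted_fS S tau n).
    apply/funext => n; apply/funext => -[c d].
    change (fS S n (set_val (c : C), set_val (d : C)) =
            fS S n (point_of (j c), point_of (j d))).
    by rewrite (jP c).2 (jP d).2.
  apply: clopen_embedding_converging => //.
  have : range j x0 by rewrite range_j.
  by move=> [c _ _]; exists c.
exists n, (j x'), (j y); split=> //; [exact: (jP x').1|exact: (jP y).1|..].
- by rewrite (jP x').2 (jP y).2.
- by move=> i ip; rewrite (jP x').2; exact: translate_mem nP ip.
Qed.

(** * Flipping along a scheme *)

Section branches.
Context (S : set nat) (X : Type) (pt : X -> cantor_space).
Context (V : nat -> set X) (n : nat -> nat) (h : nat -> X -> X).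
Hypothesis n_incr : {homo n : k l / (k < l)%N}.
Hypothesis V_decr : forall k, V k.+1 `<=` V k.
Hypothesis hV : forall k x, V k.+1 x -> V k (h k x).
Hypothesis hP : forall k x, V k.+1 x -> fS S (n k) (pt x, pt (h k x)).

(** The flip of highest index acts first: each [h k] leads from [V k.+1] to [V k], so the flips
    descend along the sequence [V]. *)
Fixpoint branch (a : cantor_space) (k : nat) : X -> X :=
  if k is k'.+1 then
    if a k' then branch a k' \o h k' else branch a k'
  else id.

Lemma eq_branch (a b : cantor_space) (k : nat) :
  initial_segment a k = initial_segment b k -> branch a k = branch b k.
Proof.
elim: k => //= k IH; rewrite /initial_segment !mkseqS => /rcons_inj[/IH -> ->].
by [].
Qed.

Lemma decreasing_le (k l : nat) : (k <= l)%N -> V l `<=` V k.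
Proof.
elim: l => [|l IH]; first by rewrite leqn0 => /eqP ->.
rewrite leq_eqVlt => /predU1P[->//|]; rewrite ltnS => /IH VV.
exact: subset_trans VV.
Qed.

(** The flips of index at least [k] stay inside [V k]; hence all longer branches end with the same
    [branch a k], the source of the Cauchy estimates. *)
Lemma branch_le (a : cantor_space) (k l : nat) (x : X) :
  (k <= l)%N -> V l x -> exists2 y, V k y & branch a l x = branch a k y.
Proof.
elim: l x => [|l IH] x; first by rewrite leqn0 => /eqP ->; exists x.
rewrite leq_eqVlt => /predU1P[->|]; first by exists x.
rewrite ltnS => kl Vx /=; case: ifPn => _; first exact: IH (hV Vx).
exact: IH (V_decr Vx).
Qed.

Lemma branch_coord (a : cantor_space) (k : nat) (x : X) : V k x ->
  (forall i, (i < k)%N -> pt (branch a k x) (n i) = a i) /\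
  (forall m, (forall i, (i < k)%N -> m <> n i) -> pt (branch a k x) m = pt x m).
Proof.
elim: k x => [//|k IH] x Vx.
have n_neq i : (i < k)%N -> n k <> n i.
  by move=> /n_incr + nki; rewrite nki ltnn.
have [_ xnk hxnk hx] := (fSP _ _ _ _).1 (hP Vx).
(* [y] is [x] after the decision at place [n k]; the remaining flips act at other places. *)
have [y [Vy by_ yE ynk]] : exists y, [/\ V k y,
    branch a k.+1 x = branch a k y,
    forall m, m <> n k -> pt y m = pt x m & pt y (n k) = a k].
  rewrite /=; case: ifPn => [ak|/negbTE ak].
    by exists (h k x); split; [exact: hV| |move=> m /hx|].
  by exists x; split => //; exact: V_decr.
have [IH1 IH2] := IH _ Vy; rewrite by_; split=> [i|m mn].
  rewrite ltnS leq_eqVlt => /predU1P[->|/IH1//].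
  by rewrite IH2.
rewrite IH2; first by apply: yE; exact: mn.
by move=> i ik; apply: mn; exact: ltnW.
Qed.

Lemma Card_branch (a : cantor_space) (k L : nat) (x : X) :
  V k x -> (forall i, (i < k)%N -> (n i < L)%N) ->
  Card (initial_segment (pt (branch a k x)) L) =
  (Card (initial_segment (pt x) L) + Card (initial_segment a k))%N.
Proof.
elim: k x => [|k IH] x Vx nL; first by rewrite addn0.
have Ca : Card (initial_segment a k.+1) = (Card (initial_segment a k) + a k)%N.
  by rewrite !Card_initial_segment big_ord_recr.
have nL' i : (i < k)%N -> (n i < L)%N by move=> ik; apply: nL; exact: ltnW.
rewrite Ca /=; case: (a k) => /=.
  rewrite IH//; last exact: hV.
  by rewrite (Card_initial_segment_fS (hP Vx) (nL _ _))// addn1 addnS addSn.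
by rewrite addn0 IH//; exact: V_decr.
Qed.

Hypothesis S_window : forall k x, V k.+1 x -> forall i, (i <= k)%N ->
  S i <-> S (Card (initial_segment (pt x) (n k)) + i)%N.

Lemma branch_limit_reduces (w : X) (u : cantor_space -> X) :
  (forall k, V k w) ->
  (forall a m, exists k0, forall k, (k0 <= k)%N ->
     pt (branch a k w) m = pt (u a) m) ->
  AS S = [set p | AS S (pt (u p.1), pt (u p.2))].
Proof.
move=> Vw uP.
have u_n a i : pt (u a) (n i) = a i.
  (* A stage at which the coordinate [n i] has stabilised and [a i] has been written there. *)
  have [k0 uk] := uP a (n i); rewrite -(uk (maxn k0 i.+1) (leq_maxl _ _)).
  by have [-> //] := branch_coord a (Vw (maxn k0 i.+1)); rewrite leq_maxr.
have u_w a m : (forall i, m <> n i) -> pt (u a) m = pt w m.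
  move=> mn; have [k0 uk] := uP a m; rewrite -(uk k0)//.
  by have [_ ->] := branch_coord a (Vw k0).
have n_inj i k : n i = n k -> i = k.
  by move=> nik; case: (ltngtP i k) => // /n_incr; rewrite nik ltnn.
(* Below [n k] the limit agrees with [branch a k w], as the places of index at least [k] are not
   below [n k]. *)
have Card_u a k : Card (initial_segment (pt (u a)) (n k)) =
    (Card (initial_segment (pt w) (n k)) + Card (initial_segment a k))%N.
  rewrite -(Card_branch a (Vw k) (fun i => @n_incr i k)); congr Card.
  apply: eq_initial_segment => m mk.
  have [b_n b_w] := branch_coord a (Vw k).
  have [[i mi]|mn] := pselect (exists i, m = n i).
    rewrite mi u_n b_n//; move: mk; rewrite mi.
    by case: (ltngtP i k) => [//|/n_incr ? ?|->]; lia.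
  rewrite u_w ?b_w// => [i _|i] mi; apply: mn; by exists i.
have SP a k : S (Card (initial_segment a k)) <->
    S (Card (initial_segment (pt (u a)) (n k))).
  by rewrite Card_u; exact: (S_window (Vw k.+1) (Card_initial_segment_le a k)).
apply/seteqP; split=> [[a b] [k _ /fSP[Sa ak bk ab]]|[a b] [m _ /fSP[Sm am bm ab]]].
- exists (n k) => //=; apply/fSP; split; rewrite ?u_n//; first exact: (SP a k).1.
  move=> m mk; have [[i mi]|mn] := pselect (exists i, m = n i).
    by rewrite mi !u_n; apply: ab => ik; apply: mk; rewrite mi ik.
  by rewrite !u_w// => i mi; apply: mn; exists i.
(* Off the places both images agree with [w], so they cannot differ there. *)
- rewrite /= in am bm ab; have [[k mk]|mn] := pselect (exists i, m = n i); last first.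
    by move: am bm; rewrite !u_w => [-> //|i mi|i mi]; apply: mn; exists i.
  subst m; exists k => //; apply/fSP; rewrite !u_n in am bm; split=> //.
    exact: (SP a k).2.
  by move=> i ik; rewrite -(u_n a) -(u_n b); apply: ab => /n_inj.
Qed.

End branches.

(** By [branch_le] and [small], the branches are Cauchy in [M] at a rate that does not depend on
    [a], which makes the limit continuous in [a]. *)
Lemma branch_limit (R : realType) (X : topologicalType) (M : pseudoMetricType R)
    (phi : X -> M) (psi : M -> X) (V : nat -> set X) (h : nat -> X -> X) :
  complete_space M -> continuous psi -> cancel phi psi ->
  (forall k, V k.+1 `<=` V k) -> (forall k x, V k.+1 x -> V k (h k x)) ->
  (forall k, closed (V k)) -> (forall k, V k !=set0) ->
  (forall a k x y, V k.+1 x -> V k.+1 y ->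
     ball (phi (branch h a k.+1 x)) (harmonic k) (phi (branch h a k.+1 y))) ->
  exists w (u : cantor_space -> X), [/\ forall k, V k w, continuous u &
    forall a, branch h a k w @[k --> \oo] --> u a].
Proof.
move=> cM psic phiK V_decr hV clV V_neq0 small.
have lim (x : nat -> X) :
    (forall k m m', (k <= m)%N -> (k <= m')%N ->
       ball (phi (x m)) (harmonic k) (phi (x m'))) ->
    exists2 l : M, x @ \oo --> psi l &
      forall k m, (k <= m)%N -> ball (phi (x m)) (harmonic k + harmonic k) l.
  move=> xC; have [l xl lP] := @complete_cvg R M (phi \o x) cM xC.
  exists l => //; have -> : x = psi \o (phi \o x) by apply/funext => k /=; rewrite phiK.
  by apply: (continuous_cvg _ _ xl); exact: psic.
have [w Vw] : exists w, forall k, V k w.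
  (* Along the all-zero sequence every branch is the identity, so [small] bounds the diameter of
     [V k.+1] itself. *)
  have /choice[x xV] k : exists x, V k.+1 x by have [x ?] := V_neq0 k.+1; exists x.
  have [k m m' km km'|l xl _] := lim x.
    have := small (fun=> false) k (x m) (x m').
    have br0 j : branch h (fun=> false) j = id by elim: j.
    by rewrite !br0; apply; apply: (decreasing_le V_decr _ (xV _)).
  exists (psi l) => k; apply: (closed_cvg (V k) (clV k) _ _ xl).
  by exists k => // m /= km; apply: (decreasing_le V_decr _ (xV _)); exact: leqW.
have /choice[l lP] a : exists l : M, branch h a k.+1 w @[k --> \oo] --> psi l /\
    forall k, ball (phi (branch h a k.+1 w)) (harmonic k + harmonic k) l.
  have [k m m' km km'|l xl lb] := lim (fun k => branch h a k.+1 w).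
    have [y Vy ->] := @branch_le _ _ _ V_decr hV a k.+1 m.+1 w km (Vw _).
    have [z Vz ->] := @branch_le _ _ _ V_decr hV a k.+1 m'.+1 w km' (Vw _).
    exact: small.
  by exists l; split=> // k; exact: lb.
exists w, (psi \o l); split=> //; last first.
  move=> a N; have [+ _] := lP a; move=> /[apply] -[k0 _ k0P].
  by exists k0.+1 => // -[//|k]; exact: k0P.
move=> a; apply: continuous_comp; last exact: psic.
(* If [b] agrees with [a] up to [k.+1], both limits are within [2 * harmonic k] of one common
   point. *)
apply/cvg_ballP => e e0; have [k ke] : exists k, harmonic k < e / 4.
  by apply: harmonic_lt; rewrite divr_gt0.
have := @near_initial_segment _ id a k.+1 (fun x => @cvg_id _ (nbhs x)).
apply: filterS => b /(eq_branch h) ba.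
have [_ /(_ k) la] := lP a; have [_ /(_ k) lb] := lP b.
rewrite ba in lb; apply: le_ball (ball_triangle (ball_sym la) lb).
by move: ke; rewrite ltr_pdivlMr//; lra.
Qed.

(** * Construction of the clopen sets, places and flips *)

Section scheme.
Context (R : realType) (S : set nat) (B : set cantor_space) (tau : topology B).
Local Notation X := (with_topology tau).
Context (M : metricType R) (phi : X -> M).
Hypotheses (phi_cts : continuous phi) (HS : hypothesis_H R S) (bB : borel B).
Hypotheses (tau_finer : finer_than_induced tau).
Hypothesis convB : converging_situation R (restricted_fS S tau).

(* Equicontinuity passes from [H] to [H `|` [set p \o h | p in H]] wherever [h]
   is continuous, so no finiteness of the family of flips needs to be tracked. *)
Definition equicontinuous_on (V : set X) (H : set (X -> X)) : Prop :=
  forall x, V x -> forall e : R, 0 < e ->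
    \forall y \near x, forall p, H p -> ball (phi (p x)) e (phi (p y)).

(** (H) yields a single point [x]; all requirements hold on a small clopen neighbourhood of it. [H]
    contains the compositions of flips built so far, and [l] is a lower bound for the new place. *)
Lemma scheme_step (k l : nat) (V : set X) (H : set (X -> X)) :
  clopen V -> V !=set0 -> equicontinuous_on V H ->
  exists (n : nat) (h : X -> X) (V' : set X),
    let H' := H `|` [set p \o h | p in H] in
    [/\ (l <= n)%N, [/\ clopen V', V' !=set0 & equicontinuous_on V' H'],
        V' `<=` V,
        forall x, V' x -> [/\ V (h x), fS S n (point_of x, point_of (h x)) &
          forall i, (i <= k)%N ->
            S i <-> S (Card (initial_segment (point_of x) n) + i)%N] &
        forall p x y, H' p -> V' x -> V' y ->
          ball (phi (p x)) (harmonic k) (phi (p y))].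
Proof.
move=> cV V0 eqH.
have [n [x [y [ln Vx Vy xy xS]]]] :=
  hypothesis_H_clopen HS bB tau_finer convB cV V0 l k.
have [[_ Xb _ _] /(_ n)[[h [g [hP hc _]]] [oD cD] _] _] := convB.
set D := pdom _ in hc oD cD.
rewrite continuous_open_subspace// in hc.
have Dh z : D z -> fS S n (point_of z, point_of (h z)).
  by move=> [[z1 z2] f12 /= <-]; rewrite -(hP _ _ f12).1.
have Dx : D x by exists (x, y).
have hx : h x = y by rewrite -(hP x y xy).1.
have hcx z : D z -> {for z, continuous h} by move=> /mem_set/hc.
set H' := H `|` [set p \o h | p in H].
(* For the new maps [p \o h], equicontinuity of [H] at [h z] is pulled back by continuity of [h] at
   [z]. *)
have eqH' : equicontinuous_on (V `&` D `&` h @^-1` V) H'.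
  move=> z [[Vz Dz] Vhz] e e0.
  have := hcx z Dz _ (eqH _ Vhz e e0).
  apply: filterS2 (eqH _ Vz e e0) => t zt hzt p [/zt//|[q Hq <-]].
  exact: hzt.
have e0 : (0 : R) < harmonic k / 2 by rewrite divr_gt0// harmonic_gt0.
(* Fixing the initial segment of length [n] carries the condition on [S] from [x] to all of [V'];
   the half radius allows two points to be compared through [x]. *)
have [V' [cV' V'x V'sub]] : exists U, [/\ clopen U, U x & U `<=`
    V `&` D `&` h @^-1` V `&`
    [set z | initial_segment (point_of z) n = initial_segment (point_of x) n] `&`
    [set z | forall p, H' p -> ball (phi (p x)) (harmonic k / 2) (phi (p z))]].
  apply: clopen_baseP => //; have [oV _] := cV.
  apply: filterI; last by apply: eqH' => //; split; [|rewrite /preimage/= hx].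
  apply: filterI; last first.
    exact: near_initial_segment (point_of_continuous tau_finer).
  apply: filterI; first by apply: filterI; apply: open_nbhs_nbhs.
  by apply: hcx => //; rewrite hx; exact: open_nbhs_nbhs.
exists n, h, V'; split=> //.
- split=> //; first by exists x.
  by move=> z /V'sub[[Vz _] _]; exact: eqH'.
- by move=> z /V'sub[[[[]]]].
- move=> z /V'sub[[[[_ Dz] Vhz] zx] _]; split=> //; first exact: Dh.
  by rewrite zx.
- move=> p z t H'p /V'sub[_ xz] /V'sub[_ xt].
  exact: ball_splitr (xz p H'p) (xt p H'p).
Qed.

Lemma scheme : exists (V : nat -> set X) (n : nat -> nat) (h : nat -> X -> X),
  [/\ {homo n : k l / (k < l)%N},
      forall k, [/\ clopen (V k), V k !=set0 & V k.+1 `<=` V k],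
      forall k x, V k.+1 x -> V k (h k x) /\
        fS S (n k) (point_of x, point_of (h k x)),
      forall k x, V k.+1 x -> forall i, (i <= k)%N ->
        S i <-> S (Card (initial_segment (point_of x) (n k)) + i)%N &
      forall a k x y, V k.+1 x -> V k.+1 y ->
        ball (phi (branch h a k.+1 x)) (harmonic k) (phi (branch h a k.+1 y))].
Proof.
(* A state holds the clopen set, the family of compositions and the least place still allowed, one
   more than the previous place. *)
pose P (k : nat) (s : set X * set (X -> X) * nat) :=
  [/\ clopen s.1.1, s.1.1 !=set0 & equicontinuous_on s.1.1 s.1.2].
pose Q (k : nat) (s s' : set X * set (X -> X) * nat) := exists (nh : nat * (X -> X)),
  [/\ (s.2 <= nh.1)%N, s' = (s'.1.1, s.1.2 `|` [set p \o nh.2 | p in s.1.2], nh.1.+1),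
      s'.1.1 `<=` s.1.1,
      forall x, s'.1.1 x -> [/\ s.1.1 (nh.2 x),
        fS S nh.1 (point_of x, point_of (nh.2 x)) & forall i, (i <= k)%N ->
            S i <-> S (Card (initial_segment (point_of x) nh.1) + i)%N] &
      forall p x y, s'.1.2 p -> s'.1.1 x -> s'.1.1 y ->
        ball (phi (p x)) (harmonic k) (phi (p y))].
have P0 : P 0%N (setT, [set id], 0%N).
  have [[X0 _ _ _] _ _] := convB; split=> //=; first by split; [exact: openT|exact: closedT].
  move=> x _ e e0; have /cvg_ballP/(_ e e0) := @phi_cts x.
  by apply: filterS => y xy p ->.
have [k [[V H] l] [/= cV V0 eqH]|s [s0 sP sQ]] := nat_dependent_choice (Q := Q) P0.
  have [n [h [V' [ln PV' VV' V'P V'small]]]] := scheme_step k l cV V0 eqH.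
  exists (V', H `|` [set p \o h | p in H], n.+1); split=> //.
  by exists (n, h); split.
have /choice[nh nhP] := sQ.
have H0 : (s 0%N).1.2 id by rewrite s0.
have HS' k : (s k.+1).1.2 = (s k).1.2 `|` [set p \o (nh k).2 | p in (s k).1.2].
  by have [_ -> _ _ _] := nhP k.
have lS k : (s k.+1).2 = (nh k).1.+1 by have [_ -> _ _ _] := nhP k.
(* Keeping [H] and adjoining all [p \o h] mirrors the two cases in the recursion of [branch]. *)
have Hb a k : (s k).1.2 (branch (fun k => (nh k).2) a k).
  elim: k => //= k IH; rewrite HS'; case: ifP => _; last by left.
  by right; exists (branch (fun k => (nh k).2) a k).
exists (fun k => (s k).1.1), (fun k => (nh k).1), (fun k => (nh k).2); split.
- apply: homo_ltn; first exact: ltn_trans.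
  by move=> k; have [+ _ _ _ _] := nhP k.+1; rewrite lS.
- by move=> k; have [? ? _] := sP k; have [_ _ ? _ _] := nhP k.
- by move=> k x; have [_ _ _ + _] := nhP k; move=> /[apply] -[].
- by move=> k x; have [_ _ _ + _] := nhP k; move=> /[apply] -[].
- by move=> a k x y Vx Vy; have [_ _ _ _ +] := nhP k; apply.
Qed.

End scheme.

Theorem theorem19 (R : realType) (S : set nat) (S_infinite : infinite_set S)
    (S0 : S 0%N) (HS : hypothesis_H R S)
    (B : set cantor_space) (tau : topology B)
    (B_borel : borel B) (tau_finer : finer_than_induced tau)
    (B_conv : converging_situation R (restricted_fS S tau)) :
  rect_reducible (AS S) (trace tau (AS S)).
Proof.
have [[_ _ _ [_ [M cM [phi [psi [phiK _ phic psic]]]]]] _ _] := B_conv.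
have [V [n [h [n_incr VP hP Swin small]]]] :=
  scheme phic HS B_borel tau_finer B_conv.
have V_decr k : V k.+1 `<=` V k by have [] := VP k.
have hV k x : V k.+1 x -> V k (h k x) by move=> /hP[].
have hf k x : V k.+1 x -> fS S (n k) (point_of x, point_of (h k x)).
  by move=> /hP[].
have [|k|w [u [Vw uc wu]]] := branch_limit cM psic phiK V_decr hV _ _ small.
- by move=> k; have [[]] := VP k.
- by have [] := VP k.
exists u, u; split=> //.
apply: (branch_limit_reduces n_incr V_decr hV hf Swin Vw) => a m.
(* As tau refines the induced topology, convergence in tau makes each coordinate eventually
   constant. *)
have [k0 _ k0P] := wu a _ (near_coordinate (u a) m (point_of_continuous tau_finer)).
by exists k0.
Qed.
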